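(* Let $$\begin{array}{ccccc} A & \xrightarrow{f} & B & \xrightarrow{g} & C\\ {\scriptstyle\alpha}\downarrow & & {\scriptstyle\beta}\downarrow & & {\scriptstyle\gamma}\downarrow\\ A' & \xrightarrow{f'} & B' & \xrightarrow{g'} & C'\end{array}$$ be a commutative diagram of abelian groups and homomorphisms with exact rows, i.e. $\beta\circ f=f'\circ\alpha$, $\gamma\circ g=g'\circ\beta$, $\operatorname{im} f=\ker g$ and $\operatorname{im} f'=\ker g'$ ($f,f'$ are not assumed injective and $g,g'$ are not assumed surjective). Then there exists a homomorphism $$\delta:\ \ker\gamma\cap\operatorname{im} g\longrightarrow A'/(\operatorname{im}\alpha+\ker f')$$ such that the sequence $$0\to\ker f\to\ker(f'\circ\alpha)\to\ker\beta\to\ker\gamma\cap\operatorname{im} g\xrightarrow{\ \delta\ }A'/(\operatorname{im}\alpha+\ker f')\to\operatorname{coker}\beta\to\operatorname{coker}(\gamma\circ g)\to\operatorname{coker} g'\to 0$$ is exact, where the maps other than $\delta$ are the natural ones described in the context. Moreover, if $f'$ is injective, then $\ker(f'\circ\alpha)=\ker\alpha$ and $A'/(\operatorname{im}\alpha+\ker f')=\operatorname{coker}\alpha$; if $g$ is surjective, then $\operatorname{coker}(\gamma\circ g)=\operatorname{coker}\gamma$ and $\ker\gamma\cap\operatorname{im} g=\ker\gamma$. Thus if $f'$ is injective and $g$ is surjective, one obtains the exact sequence $$0\to\ker f\to\ker\alpha\to\ker\beta\to\ker\gamma\xrightarrow{\ \delta\ }\operatorname{coker}\alpha\to\operatorname{coker}\beta\to\operatorname{coker}\gamma\to\operatorname{coker}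 g'\to 0.$$
   Context: For a homomorphism $\varphi:X\to Y$ of abelian groups, $\operatorname{coker}\varphi=Y/\operatorname{im}\varphi$. The natural maps in the sequence are: the inclusion $\ker f\to\ker(f'\circ\alpha)$ (since $f'\circ\alpha=\beta\circ f$); the map $\ker(f'\circ\alpha)\to\ker\beta$ induced by $f$; the map $\ker\beta\to\ker\gamma\cap\operatorname{im} g$ induced by $g$; the map $A'/(\operatorname{im}\alpha+\ker f')\to\operatorname{coker}\beta$ induced by $f'$; the map $\operatorname{coker}\beta\to\operatorname{coker}(\gamma\circ g)$ induced by $g'$ (since $\gamma\circ g=g'\circ\beta$); and the projection $\operatorname{coker}(\gamma\circ g)=C'/\operatorname{im}(\gamma\circ g)\to C'/\operatorname{im} g'=\operatorname{coker} g'$. In the last exact sequence of the claim the maps are the same ones under the stated identifications. *)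

(* Defs.v *)
(* Abelian groups are zmodTypes, homomorphisms are
   {additive _ -> _}. *)
From HB Require Import structures.
From mathcomp Require Import all_boot all_algebra.
From mathcomp Require Import boolp.

Set Implicit Arguments.
Unset Strict Implicit.
Unset Printing Implicit Defensive.

Import GRing.Theory.
Local Open Scope ring_scope.
Local Open Scope quotient_scope.

Section Subgroups.
Variables A B : zmodType.

Definition ker (f : {additive A -> B}) : {pred A} := fun x => f x == 0.

Definition im (f : {additive A -> B}) : {pred B} :=
  fun y => `[< exists x, f x = y >].

Definition capg (S T : {pred A}) : {pred A} :=
  fun x => (x \in S) && (x \in T).

Definition addg (S T : {pred A}) : {pred A} :=
  fun x => `[< exists u v, [/\ u \in S, v \in T & x = u + v] >].

Lemma kerP (f : {additive A -> B}) x : reflect (f x = 0) (x \in ker f).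
Proof. exact: eqP. Qed.

Lemma imP (f : {additive A -> B}) y :
  reflect (exists x, f x = y) (y \in im f).
Proof. exact: asboolP. Qed.

Lemma addgP (S T : {pred A}) x :
  reflect (exists u v, [/\ u \in S, v \in T & x = u + v]) (x \in addg S T).
Proof. exact: asboolP. Qed.

Lemma ker_zmod_closed f : zmod_closed (ker f).
Proof.
split=> [|x y /kerP fx /kerP fy]; apply/kerP; first exact: raddf0.
by rewrite raddfB fx fy subrr.
Qed.
HB.instance Definition _ f := GRing.isZmodClosed.Build A (ker f)
  (ker_zmod_closed f).

Lemma im_zmod_closed f : zmod_closed (im f).
Proof.
split=> [|_ _ /imP[x <-] /imP[y <-]]; apply/imP; first by exists 0; rewrite raddf0.
by exists (x - y); rewrite raddfB.
Qed.
HB.instance Definition _ f := GRing.isZmodClosed.Build B (im f)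
  (im_zmod_closed f).

Lemma capg_zmod_closed (S T : zmodClosed A) : zmod_closed (capg S T).
Proof.
split=> [|x y /andP[xS xT] /andP[yS yT]]; apply/andP; split;
  by rewrite ?rpred0 ?rpredB.
Qed.
HB.instance Definition _ (S T : zmodClosed A) :=
  GRing.isZmodClosed.Build A (capg S T) (capg_zmod_closed S T).

Lemma addg_zmod_closed (S T : zmodClosed A) : zmod_closed (addg S T).
Proof.
split=> [|_ _ /addgP[u [v [uS vT ->]]] /addgP[w [z [wS zT ->]]]]; apply/addgP.
  by exists 0, 0; rewrite !rpred0 addr0.
by exists (u - w), (v - z); rewrite !rpredB // opprD addrACA.
Qed.
HB.instance Definition _ (S T : zmodClosed A) :=
  GRing.isZmodClosed.Build A (addg S T) (addg_zmod_closed S T).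

End Subgroups.

Definition subgroup (A : zmodType) (S : zmodClosed A) := {x : A | x \in S}.
HB.instance Definition _ (A : zmodType) (S : zmodClosed A) :=
  SubChoice.on (subgroup S).
HB.instance Definition _ (A : zmodType) (S : zmodClosed A) :=
  [SubChoice_isSubZmodule of subgroup S by <:].

Notation quotg S := (Quotient.quot S).
Notation coker f := (quotg (im f)).

(* The homomorphisms induced by f on subgroups S -> T and on quotients
   A/S -> B/T, for any f mapping S into T. *)
Section InducedMaps.
Variables (A B : zmodType) (f : {additive A -> B}).
Variables (S : zmodClosed A) (T : zmodClosed B).
Hypothesis fST : {in S, forall x, f x \in T}.

Definition sub_hom (u : subgroup S) : subgroup T :=
  exist _ (f (val u)) (fST (valP u)).

Lemma sub_hom_is_zmod_morphism : zmod_morphism sub_hom.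
Proof. by move=> u v; apply/val_inj; rewrite /= !raddfB. Qed.
HB.instance Definition _ := GRing.isZmodMorphism.Build
  (subgroup S) (subgroup T) sub_hom sub_hom_is_zmod_morphism.

(* The argument fST is unused in the body, but is what makes quot_hom
   additive and independent of the representative repr q (quot_homE). *)
Definition quot_hom of {in S, forall x, f x \in T} :=
  fun q : quotg S => \pi_(quotg T) (f (repr q)).

Lemma quot_homE (x : A) :
  quot_hom fST (\pi_(quotg S) x) = \pi_(quotg T) (f x).
Proof.
apply/eqP; rewrite -Quotient.idealrBE -raddfB fST // Quotient.idealrBE.
by rewrite reprK.
Qed.

Lemma quot_hom_is_zmod_morphism : zmod_morphism (quot_hom fST).
Proof.
move=> p q; rewrite -[p]reprK -[q]reprK -raddfB !quot_homE.
by rewrite !raddfB.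
Qed.
HB.instance Definition _ := GRing.isZmodMorphism.Build
  (quotg S) (quotg T) (quot_hom fST) quot_hom_is_zmod_morphism.

End InducedMaps.

Arguments sub_hom {A B} f S T fST.
Arguments quot_hom {A B} f S T _.

Definition exact_at (X Y Z : zmodType) (u : {additive X -> Y})
  (v : {additive Y -> Z}) : Prop := im u =i ker v.

(* Exactness of 0 -> X1 -> ... -> X8 -> 0; 'I_1 = Z/1Z is the trivial group. *)
Definition exact8 (X1 X2 X3 X4 X5 X6 X7 X8 : zmodType)
    (u1 : {additive X1 -> X2}) (u2 : {additive X2 -> X3})
    (u3 : {additive X3 -> X4}) (u4 : {additive X4 -> X5})
    (u5 : {additive X5 -> X6}) (u6 : {additive X6 -> X7})
    (u7 : {additive X7 -> X8}) : Prop :=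
  [/\ exact_at (\0 : {additive 'I_1 -> X1}) u1, exact_at u1 u2,
      exact_at u2 u3 & exact_at u3 u4] /\
  [/\ exact_at u4 u5, exact_at u5 u6, exact_at u6 u7 &
      exact_at u7 (\0 : {additive X8 -> 'I_1})].

Section Ladder.
Variables (A B C A' B' C' : zmodType).
Variables (f : {additive A -> B}) (g : {additive B -> C}).
Variables (f' : {additive A' -> B'}) (g' : {additive B' -> C'}).
Variables (alpha : {additive A -> A'}) (beta : {additive B -> B'}).
Variable gamma : {additive C -> C'}.

Section LeftSquare.
Hypothesis betaf : beta \o f =1 f' \o alpha.

Lemma ker_f_sub : {in ker f, forall x, idfun x \in ker (f' \o alpha)}.
Proof.
by move=> x /kerP fx; apply/kerP; rewrite -[LHS]betaf /= fx raddf0.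
Qed.

Lemma f_ker_comp : {in ker (f' \o alpha), forall x, f x \in ker beta}.
Proof. by move=> x /kerP fax; apply/kerP; rewrite [LHS]betaf. Qed.

Lemma f'_im_add_ker :
  {in addg (im alpha) (ker f'), forall x, f' x \in im beta}.
Proof.
move=> _ /addgP[_ [v [/imP[x <-] /kerP f'v ->]]]; apply/imP.
by exists (f x); rewrite [LHS]betaf raddfD f'v addr0.
Qed.

Lemma ker_f_sub_ker_alpha (f'_inj : injective f') :
  {in ker f, forall x, idfun x \in ker alpha}.
Proof.
move=> x /ker_f_sub /kerP fax; apply/kerP/f'_inj.
by rewrite [LHS]fax raddf0.
Qed.

Lemma f_ker_alpha : {in ker alpha, forall x, f x \in ker beta}.
Proof. by move=> x /kerP ax; apply/kerP; rewrite [LHS]betaf /= ax raddf0. Qed.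

Lemma f'_im_alpha : {in im alpha, forall x, f' x \in im beta}.
Proof. by move=> _ /imP[x <-]; apply/imP; exists (f x); rewrite [LHS]betaf. Qed.

End LeftSquare.

Section RightSquare.
Hypothesis gammag : gamma \o g =1 g' \o beta.

Lemma g_ker_beta : {in ker beta, forall x, g x \in ker gamma}.
Proof. by move=> x /kerP bx; apply/kerP; rewrite [LHS]gammag /= bx raddf0. Qed.

Lemma g_ker_beta_cap :
  {in ker beta, forall x, g x \in capg (ker gamma) (im g)}.
Proof.
by move=> x /g_ker_beta gx; apply/andP; split=> //; apply/imP; exists x.
Qed.

Lemma g'_im_beta_comp : {in im beta, forall y, g' y \in im (gamma \o g)}.
Proof.
by move=> _ /imP[x <-]; apply/imP; exists x; rewrite [LHS]gammag.
Qed.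

Lemma im_comp_sub : {in im (gamma \o g), forall z, idfun z \in im g'}.
Proof.
by move=> _ /imP[x <-]; apply/imP; exists (beta x); rewrite -[LHS]gammag.
Qed.

Lemma g'_im_beta : {in im beta, forall y, g' y \in im gamma}.
Proof.
by move=> _ /imP[x <-]; apply/imP; exists (g x); rewrite [LHS]gammag.
Qed.

Lemma im_gamma_sub (g_surj : forall z, exists y, g y = z) :
  {in im gamma, forall z, idfun z \in im g'}.
Proof.
move=> _ /imP[z <-]; have [y <-] := g_surj z; apply/imP.
by exists (beta y); rewrite -[LHS]gammag.
Qed.

End RightSquare.

Lemma cap_sub_ker :
  {in capg (ker gamma) (im g), forall z, idfun z \in ker gamma}.
Proof. by move=> z /andP[]. Qed.

Lemma im_alpha_sub_add :
  {in im alpha, forall x, idfun x \in addg (im alpha) (ker f')}.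
Proof.
by move=> x xa; apply/addgP; exists x, 0; rewrite rpred0 addr0.
Qed.

Lemma im_comp_sub_im : {in im (gamma \o g), forall z, idfun z \in im gamma}.
Proof. by move=> _ /imP[x <-]; apply/imP; exists (g x). Qed.

End Ladder.

Arguments cap_sub_ker {B C C'} g gamma.
Arguments im_alpha_sub_add {A A' B'} f' alpha.
Arguments im_comp_sub_im {B C C'} g gamma.

(* Main.v *)
Require Import Defs.
From HB Require Import structures.
From mathcomp Require Import all_boot all_algebra.
From mathcomp Require Import boolp.

Set Implicit Arguments.
Unset Strict Implicit.
Unset Printing Implicit Defensive.

Import GRing.Theory.
Local Open Scope ring_scope.

(** The connecting homomorphism is the zigzag C <- B -> B' <- A': an element
    z = g y of ker gamma is related to every a' with f' a' = beta y.  Such an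
    a' exists because g' (beta y) = gamma z = 0, so beta y lies in
    ker g' = im f'.  The relation is additive, and the values related to 0 are
    the a' with f' a' = beta (f a) = f' (alpha a) for some a, that is,
    those of im alpha + ker f'.  Hence it is the graph of a homomorphism into
    the quotient A' / (im alpha + ker f') ([additive_relation_hom],
    [connecting_hom]).  Dividing by ker f' makes up for
    the choice of a' above beta y, and intersecting with im g provides the
    lift y.

    Exactness is then a diagram chase at each of the eight places, carried out
    on representatives.

    When f' is injective or g is surjective, the subgroups of the first
    sequence change only in their description, not in their elements.
    The chase is therefore done once, in [snake_sequence], for arbitrary
    subgroups K, N, I, J that have the same elements as ker (f' \o alpha),
    ker gamma :&: im g, im alpha + ker f' and im (gamma \o g); both sequences
    are instances.  The two connecting maps agree because each is determined
    by the zigzag relation, which does not mention these subgroups. *)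

(** * Induced maps on representatives *)

Lemma pi_quotgE (A : zmodType) (S : zmodClosed A) (x y : A) :
  (\pi_(quotg S) x = \pi_(quotg S) y)%qT <-> x - y \in S.
Proof.
rewrite Quotient.idealrBE; split=> [->|/eqP //]; exact: eqxx.
Qed.

Lemma pi_quotg_eq0 (A : zmodType) (S : zmodClosed A) (x : A) :
  (\pi_(quotg S) x = 0)%qT <-> x \in S.
Proof.
by rewrite -[in X in X <-> _](raddf0 (\pi_(quotg S))%qT) pi_quotgE subr0.
Qed.

Lemma quotg_ind (A : zmodType) (S : zmodClosed A) (P : quotg S -> Prop) :
  (forall x, P (\pi_(quotg S) x)%qT) -> forall q, P q.
Proof. by move=> piP q; rewrite -[q]reprK. Qed.

Section InducedMapsMembership.
Variables (A B : zmodType) (f : {additive A -> B}).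
Variables (S : zmodClosed A) (T : zmodClosed B).
Variable fST : {in S, forall x, f x \in T}.

Lemma ker_sub_homP (u : subgroup S) :
  u \in ker (sub_hom f S T fST) <-> f (val u) = 0.
Proof.
split=> [/kerP/(congr1 val) //|fu0]; apply/kerP; exact: val_inj.
Qed.

Lemma im_sub_homP (v : subgroup T) :
  v \in im (sub_hom f S T fST) <-> exists2 x, x \in S & f x = val v.
Proof.
split=> [/imP[u <-]|[x xS fx]]; first by exists (val u); first exact: valP.
by apply/imP; exists (exist _ x xS); apply: val_inj.
Qed.

Lemma ker_quot_homP (x : A) :
  (\pi_(quotg S) x)%qT \in ker (quot_hom f S T fST) <-> f x \in T.
Proof.
rewrite -(pi_quotg_eq0 T) -(quot_homE fST).
by split=> [/kerP //|fx0]; apply/kerP.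
Qed.

Lemma im_quot_homP (y : B) :
  (\pi_(quotg T) y)%qT \in im (quot_hom f S T fST) <-> exists x, y - f x \in T.
Proof.
split=> [/imP[q]|[x /pi_quotgE yx]].
  by elim/quotg_ind: q => x; rewrite /= quot_homE => /esym/pi_quotgE; exists x.
by apply/imP; exists (\pi_(quotg S) x)%qT; rewrite /= quot_homE.
Qed.

(** If S is exactly the preimage of T, no nonzero class is killed and every
    class is reached as soon as f is onto; this covers quotients by two
    descriptions of the same subgroup. *)
Lemma quot_hom_bij :
  (forall x, f x \in T -> x \in S) -> (forall y, exists x, f x = y) ->
  bijective (quot_hom f S T fST).
Proof.
move=> fTS f_surj; pose s y := projT1 (cid (f_surj y)).
have fK y : f (s y) = y by rewrite /s; case: cid.
have sK : cancel (fun q => (\pi_(quotg S) (s (repr q)))%qT)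
                 (quot_hom f S T fST).
  by move=> q; rewrite quot_homE fK reprK.
exists (fun q => (\pi_(quotg S) (s (repr q)))%qT) => //.
suff inj : injective (quot_hom f S T fST) by move=> p; apply: inj; rewrite sK.
apply: raddf_inj; elim/quotg_ind => x.
by rewrite /= quot_homE => /pi_quotg_eq0/fTS/pi_quotg_eq0.
Qed.

End InducedMapsMembership.

Lemma eq_mem_iff (T : Type) (P Q : {pred T}) :
  (forall x, x \in P <-> x \in Q) -> P =i Q.
Proof. by move=> PQ x; apply/idP/idP => /PQ. Qed.

Lemma exact_at_0l (X Y : zmodType) (u : {additive X -> Y}) :
  (forall x, u x = 0 -> x = 0) -> exact_at (\0 : {additive 'I_1 -> X}) u.
Proof.
move=> u_inj; apply: eq_mem_iff => x; split=> [/imP[i <-]|/kerP/u_inj ->].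
  exact: rpred0.
exact: rpred0.
Qed.

Lemma exact_at_0r (X Y : zmodType) (u : {additive X -> Y}) :
  (forall y, exists x, u x = y) -> exact_at u (\0 : {additive Y -> 'I_1}).
Proof.
move=> u_surj; apply: eq_mem_iff => y; split=> _; first exact/kerP.
exact/imP/u_surj.
Qed.

(** * The connecting homomorphism *)

(** An additive relation with a value at every point is a homomorphism modulo
    its indeterminacy, the set of values at 0: subtracting two values at x
    gives a value at 0, and subtracting values at x and y gives a value at
    x - y. *)
Lemma additive_relation_hom (X Y : zmodType) (S : zmodClosed Y)
    (R : X -> Y -> Prop) :
  (forall x, exists y, R x y) ->
  (forall x1 x2 y1 y2, R x1 y1 -> R x2 y2 -> R (x1 - x2) (y1 - y2)) ->
  (forall y, R 0 y -> y \in S) ->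
  exists d : {additive X -> quotg S},
    forall x y, R x y -> d x = (\pi_(quotg S) y)%qT.
Proof.
move=> R_total RB R0.
pose d x : quotg S := (\pi_(quotg S) (projT1 (cid (R_total x))))%qT.
have dE x y : R x y -> d x = (\pi_(quotg S) y)%qT.
  rewrite /d; case: cid => y' /= Rxy' Rxy; apply/pi_quotgE/R0.
  by rewrite -(subrr x); apply: RB.
have d_zmod : zmod_morphism d.
  move=> x1 x2; have [[y1 Ry1] [y2 Ry2]] := (R_total x1, R_total x2).
  by rewrite (dE _ _ Ry1) (dE _ _ Ry2) (dE _ _ (RB _ _ _ _ Ry1 Ry2)) raddfB.
pose dM := GRing.isZmodMorphism.Build X (quotg S) d d_zmod.
pose dA : {additive X -> quotg S} := HB.pack d dM.
by exists dA.
Qed.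

Section Snake.
Variables (A B C A' B' C' : zmodType).
Variables (f : {additive A -> B}) (g : {additive B -> C}).
Variables (f' : {additive A' -> B'}) (g' : {additive B' -> C'}).
Variables (alpha : {additive A -> A'}) (beta : {additive B -> B'}).
Variable gamma : {additive C -> C'}.
Variables (betaf : beta \o f =1 f' \o alpha).
Variables (gammag : gamma \o g =1 g' \o beta).
Variables (exact_fg : exact_at f g) (exact_fg' : exact_at f' g').

Lemma ker_gP y : g y = 0 <-> exists x, f x = y.
Proof.
by split=> [/kerP|/imP fx]; [|apply/kerP]; rewrite -exact_fg // => /imP.
Qed.

Lemma ker_g'P y : g' y = 0 <-> exists x, f' x = y.
Proof.
by split=> [/kerP|/imP fx]; [|apply/kerP]; rewrite -exact_fg' // => /imP.
Qed.

Variables (K : zmodClosed A) (N : zmodClosed C).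
Variables (I : zmodClosed A') (J : zmodClosed C').
Variables (KE : K =i ker (f' \o alpha)) (NE : N =i capg (ker gamma) (im g)).
Variables (IE : I =i addg (im alpha) (ker f')) (JE : J =i im (gamma \o g)).

Definition zigzag (z : C) (a' : A') := exists2 y, g y = z & beta y = f' a'.

Lemma zigzag_total z : z \in N -> exists a', zigzag z a'.
Proof.
rewrite NE => /andP[/kerP cz /imP[y gy]].
have /ker_g'P[a' fa'] : g' (beta y) = 0 by rewrite -[LHS]gammag /= gy.
by exists a', y.
Qed.

Lemma zigzagB z1 z2 a1 a2 :
  zigzag z1 a1 -> zigzag z2 a2 -> zigzag (z1 - z2) (a1 - a2).
Proof.
move=> [y1 gy1 by1] [y2 gy2 by2].
by exists (y1 - y2); rewrite raddfB (gy1, by1) (gy2, by2) ?raddfB.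
Qed.

(** Membership in im alpha + ker f' is tested after applying f', where the
    commutative square turns f' (alpha x) into beta (f x). *)
Lemma mem_indeterminacyP a' : a' \in I <-> exists x, f' a' = f' (alpha x).
Proof.
rewrite IE; split=> [/addgP[_ [v [/imP[x <-] /kerP f'v ->]]]|[x fx]].
  by exists x; rewrite raddfD f'v addr0.
apply/addgP; exists (alpha x), (a' - alpha x); split.
- by apply/imP; exists x.
- by apply/kerP; rewrite raddfB fx subrr.
- by rewrite addrC subrK.
Qed.

(** A lift of z along g is determined up to im f, and beta (f x) is
    f' (alpha x): the zigzags over z that end in I are those whose lift can be
    corrected to one in ker beta. *)
Lemma zigzag_indeterminacyP z a' :
  zigzag z a' -> a' \in I <-> exists2 y, y \in ker beta & g y = z.
Proof.
move=> [y gy by_]; split=> [/mem_indeterminacyP[x fx]|[y0 /kerP by0 gy0]].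
  exists (y - f x); first by apply/kerP; rewrite raddfB by_ fx [beta _]betaf subrr.
  have /ker_gP gfx : exists x0, f x0 = f x by exists x.
  by rewrite raddfB gfx subr0.
have /ker_gP[x fx] : g (y - y0) = 0 by rewrite raddfB gy gy0 subrr.
apply/mem_indeterminacyP; exists x.
by rewrite -[RHS]betaf /= fx raddfB by0 subr0 by_.
Qed.

Lemma connecting_hom : exists delta : {additive subgroup N -> quotg I},
  forall u a', zigzag (val u) a' -> delta u = (\pi_(quotg I) a')%qT.
Proof.
apply: (additive_relation_hom (R := fun u => zigzag (val u))).
- by move=> u; apply/zigzag_total/valP.
- by move=> u1 u2 a1 a2; rewrite raddfB; apply: zigzagB.
- move=> a' za'; apply/(zigzag_indeterminacyP za').
  by exists 0; rewrite ?rpred0 ?raddf0.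
Qed.

(** * Exactness *)

Variables (iK : {in ker f, forall x, idfun x \in K}).
Variables (fK : {in K, forall x, f x \in ker beta}).
Variables (gN : {in ker beta, forall y, g y \in N}).
Variables (f'I : {in I, forall a', f' a' \in im beta}).
Variables (g'J : {in im beta, forall y', g' y' \in J}).
Variables (pJ : {in J, forall z', idfun z' \in im g'}).

Lemma exact_at_ker_f :
  exact_at (\0 : {additive 'I_1 -> _}) (sub_hom idfun (ker f) K iK).
Proof. by apply: exact_at_0l => u /(congr1 val) u0; apply: val_inj. Qed.

Lemma exact_at_ker_f'alpha :
  exact_at (sub_hom idfun (ker f) K iK) (sub_hom f K (ker beta) fK).
Proof.
apply: eq_mem_iff => u; rewrite im_sub_homP ker_sub_homP.
by split=> [[x /kerP fx <-] //|fu]; exists (val u) => //; apply/kerP.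
Qed.

Lemma exact_at_ker_beta :
  exact_at (sub_hom f K (ker beta) fK) (sub_hom g (ker beta) N gN).
Proof.
apply: eq_mem_iff => u; rewrite im_sub_homP ker_sub_homP ker_gP.
split=> [[x _ fx]|[x fx]]; exists x => //.
by rewrite KE; apply/kerP; rewrite -[LHS]betaf /= fx; apply/kerP/valP.
Qed.

(** Exactness of the bottom row corrects y' by an element beta y: if g' y' is
    gamma (g y) = g' (beta y), then y' - beta y is in ker g' = im f'. *)
Lemma exact_at_coker_beta :
  exact_at (quot_hom f' I (im beta) f'I) (quot_hom g' (im beta) J g'J).
Proof.
apply: eq_mem_iff; elim/quotg_ind => y'; rewrite im_quot_homP ker_quot_homP JE.
split=> [[a' /imP[y by_]]|/imP[y gy]].
  have /ker_g'P g'fa' : exists a, f' a = f' a' by exists a'.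
  by apply/imP; exists y; rewrite [LHS]gammag /= by_ raddfB g'fa' subr0.
have /ker_g'P[a' fa'] : g' (y' - beta y) = 0.
  by rewrite raddfB -gy -[g' (beta y)]gammag subrr.
by exists a'; rewrite fa' subKr; apply/imP; exists y.
Qed.

Lemma exact_at_coker_gammag :
  exact_at (quot_hom g' (im beta) J g'J) (quot_hom idfun J (im g') pJ).
Proof.
apply: eq_mem_iff; elim/quotg_ind => z'; rewrite im_quot_homP ker_quot_homP.
split=> [[y' /pJ zy']|/imP[y' gy']]; last by exists y'; rewrite gy' subrr rpred0.
by rewrite -(subrK (g' y') z') rpredD //; apply/imP; exists y'.
Qed.

Lemma exact_at_coker_g' :
  exact_at (quot_hom idfun J (im g') pJ) (\0 : {additive _ -> 'I_1}).
Proof.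
apply: exact_at_0r; elim/quotg_ind => z'.
by exists (\pi_(quotg J) z')%qT; rewrite /= quot_homE.
Qed.

Variable delta : {additive subgroup N -> quotg I}.
Variable deltaE :
  forall u a', zigzag (val u) a' -> delta u = (\pi_(quotg I) a')%qT.

Lemma exact_at_ker_gamma : exact_at (sub_hom g (ker beta) N gN) delta.
Proof.
apply: eq_mem_iff => u; have [a' za'] := zigzag_total (valP u).
rewrite im_sub_homP -(zigzag_indeterminacyP za') -pi_quotg_eq0 -(deltaE za').
by split=> /kerP.
Qed.

(** If f' a' = beta y, then a' ends a zigzag that starts at g y, and
    gamma (g y) = g' (f' a') = 0 puts g y in the domain of delta. *)
Lemma exact_at_coker_alpha : exact_at delta (quot_hom f' I (im beta) f'I).
Proof.
apply: eq_mem_iff; elim/quotg_ind => a'; rewrite ker_quot_homP.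
split=> [/imP[u]|/imP[y by_]].
  have [a za] := zigzag_total (valP u); rewrite (deltaE za) => /esym/pi_quotgE.
  move/f'I; rewrite raddfB; have [y _ <-] := za => a'y.
  by rewrite -(subrK (beta y) (f' a')) rpredD //; apply/imP; exists y.
have gyN : g y \in N.
  rewrite NE; apply/andP; split; last by apply/imP; exists y.
  by apply/kerP; rewrite [LHS]gammag /= by_; apply/ker_g'P; exists a'.
by apply/imP; exists (exist _ (g y) gyN); apply: deltaE; exists y.
Qed.

Lemma snake_sequence :
  exact8 (sub_hom idfun (ker f) K iK) (sub_hom f K (ker beta) fK)
    (sub_hom g (ker beta) N gN) delta (quot_hom f' I (im beta) f'I)
    (quot_hom g' (im beta) J g'J) (quot_hom idfun J (im g') pJ).
Proof.
split; split.
- exact: exact_at_ker_f.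
- exact: exact_at_ker_f'alpha.
- exact: exact_at_ker_beta.
- exact: exact_at_ker_gamma.
- exact: exact_at_coker_alpha.
- exact: exact_at_coker_beta.
- exact: exact_at_coker_gammag.
- exact: exact_at_coker_g'.
Qed.

End Snake.

(** * The injective and surjective cases *)

Section Degenerate.
Variables (A B C A' B' C' : zmodType).
Variables (g : {additive B -> C}) (f' : {additive A' -> B'}).
Variables (alpha : {additive A -> A'}) (gamma : {additive C -> C'}).

Lemma ker_comp_inj : injective f' -> ker (f' \o alpha) =i ker alpha.
Proof.
move=> f'_inj; apply: eq_mem_iff => x; split=> /kerP ax; apply/kerP.
  by apply: f'_inj; rewrite [LHS]ax raddf0.
by rewrite /= ax raddf0.
Qed.

Lemma addg_ker_inj : injective f' -> addg (im alpha) (ker f') =i im alpha.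
Proof.
move=> f'_inj; apply: eq_mem_iff => a'; split; last exact: im_alpha_sub_add.
move=> /addgP[u [v [ua /kerP f'v ->]]].
have -> : v = 0 by apply: f'_inj; rewrite f'v raddf0.
by rewrite addr0.
Qed.

Lemma im_comp_surj :
  (forall z, exists y, g y = z) -> im (gamma \o g) =i im gamma.
Proof.
move=> g_surj; apply: eq_mem_iff => z'; split; first exact: im_comp_sub_im.
by move=> /imP[z <-]; have [y <-] := g_surj z; apply/imP; exists y.
Qed.

Lemma capg_im_surj :
  (forall z, exists y, g y = z) -> capg (ker gamma) (im g) =i ker gamma.
Proof.
move=> g_surj z; apply/andP/idP => [[]//|cz]; split=> //.
exact/imP/g_surj.
Qed.

End Degenerate.

Theorem theorem1 (A B C A' B' C' : zmodType)
    (f : {additive A -> B}) (g : {additive B -> C})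
    (f' : {additive A' -> B'}) (g' : {additive B' -> C'})
    (alpha : {additive A -> A'}) (beta : {additive B -> B'})
    (gamma : {additive C -> C'})
    (betaf : beta \o f =1 f' \o alpha) (gammag : gamma \o g =1 g' \o beta)
    (exact_fg : exact_at f g) (exact_fg' : exact_at f' g') :
  exists delta : {additive subgroup (capg (ker gamma) (im g))
                           -> quotg (addg (im alpha) (ker f'))},
  [/\ exact8
        (sub_hom idfun (ker f) (ker (f' \o alpha)) (ker_f_sub betaf))
        (sub_hom f (ker (f' \o alpha)) (ker beta) (f_ker_comp betaf))
        (sub_hom g (ker beta) (capg (ker gamma) (im g)) (g_ker_beta_cap gammag))
        delta
        (quot_hom f' (addg (im alpha) (ker f')) (im beta) (f'_im_add_ker betaf))
        (quot_hom g' (im beta) (im (gamma \o g)) (g'_im_beta_comp gammag))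
        (quot_hom idfun (im (gamma \o g)) (im g') (im_comp_sub gammag)),

      injective f' ->
        [/\ ker (f' \o alpha) =i ker alpha,
            addg (im alpha) (ker f') =i im alpha
          & bijective (quot_hom idfun (im alpha) (addg (im alpha) (ker f'))
                         (im_alpha_sub_add f' alpha))],

      (forall z, exists y, g y = z) ->
        [/\ im (gamma \o g) =i im gamma,
            bijective (quot_hom idfun (im (gamma \o g)) (im gamma)
                         (im_comp_sub_im g gamma))
          & capg (ker gamma) (im g) =i ker gamma]

    & forall (f'_inj : injective f') (g_surj : forall z, exists y, g y = z),
      exists delta' : {additive subgroup (ker gamma) -> coker alpha},
        (forall u : subgroup (capg (ker gamma) (im g)),
           quot_hom idfun (im alpha) (addg (im alpha) (ker f'))
             (im_alpha_sub_add f' alpha)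
             (delta' (sub_hom idfun (capg (ker gamma) (im g)) (ker gamma)
                        (cap_sub_ker g gamma) u))
           = delta u) /\
        exact8
          (sub_hom idfun (ker f) (ker alpha) (ker_f_sub_ker_alpha betaf f'_inj))
          (sub_hom f (ker alpha) (ker beta) (f_ker_alpha betaf))
          (sub_hom g (ker beta) (ker gamma) (g_ker_beta gammag))
          delta'
          (quot_hom f' (im alpha) (im beta) (f'_im_alpha betaf))
          (quot_hom g' (im beta) (im gamma) (g'_im_beta gammag))
          (quot_hom idfun (im gamma) (im g') (im_gamma_sub gammag g_surj))].
Proof.
have [delta deltaE] := connecting_hom betaf gammag exact_fg exact_fg'
  (N := capg (ker gamma) (im g)) (I := addg (im alpha) (ker f'))
  (fun=> erefl) (fun=> erefl).
exists delta; split.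
- exact: (snake_sequence betaf gammag exact_fg exact_fg').
- move=> f'_inj; split; [exact: ker_comp_inj|exact: addg_ker_inj|].
  apply: quot_hom_bij => [x|y]; last by exists y.
  by rewrite addg_ker_inj.
- move=> g_surj; split; [exact: im_comp_surj| |exact: capg_im_surj].
  apply: quot_hom_bij => [x|y]; last by exists y.
  by rewrite im_comp_surj.
- move=> f'_inj g_surj.
  have NE := fsym (capg_im_surj gamma g_surj).
  have IE := fsym (addg_ker_inj alpha f'_inj).
  have [delta' delta'E] := connecting_hom betaf gammag exact_fg exact_fg' NE IE.
  exists delta'; split=> [u|].
    (* One zigzag starting at u computes both connecting maps. *)
    have [a' za'] := zigzag_total gammag exact_fg' (fun=> erefl) (valP u).
    have -> := delta'E (sub_hom idfun _ _ (cap_sub_ker g gamma) u) a' za'.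
    by rewrite (deltaE u a' za') quot_homE.
  apply: (snake_sequence betaf gammag exact_fg exact_fg') => //.
    exact: fsym (ker_comp_inj alpha f'_inj).
  exact: fsym (im_comp_surj gamma g_surj).
Qed.
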